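(* Let $K_4$ be the complete $3$-graph on $4$ vertices and $F_{3,2}$ the $3$-graph on $\{1,\dots,5\}$ with edges $123,124,125,345$. Then \[\pi_{K_4}(\{F_{3,2}\})=\frac{3}{32}.\]
   Context: A $3$-graph is a pair $G=(V,E)$ with $E$ a set of $3$-element subsets of $V$. For a $3$-graph $H$ on $h$ vertices and a $3$-graph $G$ on $n\ge h$ vertices, $e_H(G)$ is the number of $h$-subsets of $V(G)$ inducing a subgraph isomorphic to $H$. For a family $\mathcal{F}$ of $3$-graphs, $G$ is $\mathcal{F}$-free if it contains no member of $\mathcal{F}$ as a (not necessarily induced) subgraph. $\mathrm{ex}_H(n,\mathcal{F})$ is the maximum of $e_H(G)$ over $\mathcal{F}$-free $G$ on $n$ vertices, and $\pi_H(\mathcal{F})=\lim_{n\to\infty}\mathrm{ex}_H(n,\mathcal{F})/\binom{n}{h}$ (the limit exists). *)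

(* Defs.v *)
From HB Require Import structures.
From mathcomp Require Import all_boot all_order all_algebra.
From mathcomp Require Import all_classical all_reals all_analysis.
Set Implicit Arguments.
Unset Strict Implicit.
Unset Printing Implicit Defensive.
Import Order.TTheory GRing.Theory Num.Theory numFieldNormedType.Exports.
Local Open Scope ring_scope.

Record graph3 (T : finType) := Graph3 {
  edges : {set {set T}};
  edgesP : [forall e in edges, #|e| == 3%N]
}.

HB.instance Definition _ (T : finType) := [isSub for @edges T].
HB.instance Definition _ (T : finType) := [Finite of graph3 T by <:].

Lemma induced_edgesP (T : finType) (G : graph3 T) (S : {set T}) :
  [forall e in [set e : {set {x : T | x \in S}} | val @: e \in edges G],
     #|e| == 3%N].
Proof.
apply/forall_inP => e; rewrite inE => eG.
by rewrite -(card_imset _ val_inj) (forall_inP (edgesP G)).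
Qed.

Definition induced_subgraph (T : finType) (G : graph3 T) (S : {set T}) :
  graph3 {x : T | x \in S} := Graph3 (induced_edgesP G S).

Definition isomorphic (T U : finType) (G : graph3 T) (H : graph3 U) : Prop :=
  exists2 f : T -> U, bijective f &
    forall e : {set T}, (e \in edges G) = (f @: e \in edges H).

Definition contains (T U : finType) (G : graph3 T) (H : graph3 U) : Prop :=
  exists2 f : U -> T, injective f &
    forall e : {set U}, e \in edges H -> f @: e \in edges G.

Definition graph3_family := set {m : nat & graph3 'I_m}.

Definition Ffree (T : finType) (F : graph3_family) (G : graph3 T) : Prop :=
  forall m (H : graph3 'I_m), F (existT _ m H) -> ~ contains G H.

Definition ecount (h : nat) (H : graph3 'I_h) (T : finType) (G : graph3 T) :
  nat :=
  #|[set S : {set T} | (#|S| == h) && `[< isomorphic (induced_subgraph G S) H >]]|.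

Definition exH (h : nat) (H : graph3 'I_h) (n : nat) (F : graph3_family) : nat :=
  (\max_(G : graph3 'I_n | `[< Ffree F G >]) ecount H G)%N.

Definition ex_ratio (R : realType) (h : nat) (H : graph3 'I_h) (F : graph3_family)
  (n : nat) : R := (exH H n F)%:R / 'C(n, h)%:R.

Definition turan_density (R : realType) (h : nat) (H : graph3 'I_h)
  (F : graph3_family) : R := limn (ex_ratio R H F).

(* [limn] is total and returns 0 on divergent sequences, so a nonzero value of
   [turan_density] is always a genuine limit. *)
Lemma turan_density_cvg (R : realType) (h : nat) (H : graph3 'I_h)
    (F : graph3_family) : turan_density R H F != 0 ->
  (ex_ratio R H F @ \oo --> turan_density R H F)%classic.
Proof.
by move=> nz; apply: contrapT => /dvgP d0; rewrite /turan_density d0 eqxx in nz.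
Qed.

Lemma complete_edgesP (n : nat) :
  [forall e in [set e : {set 'I_n} | #|e| == 3%N], #|e| == 3%N].
Proof. by apply/forall_inP => e; rewrite inE. Qed.

Definition complete3 (n : nat) : graph3 'I_n := Graph3 (complete_edgesP n).

Definition K4 : graph3 'I_4 := complete3 4.

(* The triple abc, where the vertices 1, ..., 5 are the elements 0, ..., 4 of
   ['I_5]. *)
Definition triple5 (a b c : nat) : {set 'I_5} :=
  [set inord a.-1; inord b.-1; inord c.-1].

Lemma F32_edgesP :
  [forall e in [set triple5 1 2 3; triple5 1 2 4; triple5 1 2 5;
                    triple5 3 4 5], #|e| == 3%N].
Proof.
apply/forall_inP => e; rewrite !inE => e_in.
by case/orP: e_in => [/orP[/orP[]|]|] /eqP->;
  rewrite /triple5 -finset.setUA !cardsU1 cards1 !inE -!val_eqE /= !inordK.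
Qed.

Definition F32 : graph3 'I_5 := Graph3 F32_edgesP.

(* Main.v *)
Require Import Defs.
From mathcomp Require Import all_boot all_order all_algebra.
From mathcomp Require Import all_classical all_reals all_analysis.
From mathcomp Require Import ring lra zify.
Set Implicit Arguments.
Unset Strict Implicit.
Unset Printing Implicit Defensive.
Import Order.TTheory GRing.Theory Num.Theory numFieldNormedType.Exports.
Local Open Scope ring_scope.

(** Lower bound: the balanced complete 4-partite 3-graph is F_{3,2}-free and has
    about (n/4)^4 copies of K_4.

    Upper bound: in an F_{3,2}-free 3-graph G every pair has an independent
    neighbourhood. Let d(ab) be the density of the neighbourhood of the pair ab,
    s(abc) the density of the set of vertices completing abc to a K_4, and let
    H(a) be the average over z of h(d(az)), where h(x) = 3x for x < 1/5 and
    h(x) = 1 otherwise. The weights h(d(ab)) / (H(a) d(ab) s(abc)), summed over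
    all ordered copies abcd of K_4, telescope to at most n^4. It then suffices
    that over the 24 orderings of a single K_4 the weights add up to at least
    256, since this bounds the number of ordered copies by (3/32) n^4.

    Fix a copy abcd and let S_a, S_b, S_c, S_d be the sets of vertices that
    complete its four triples. Independence of neighbourhoods makes these sets
    disjoint, and a vertex forms an edge with at most three of the six pairs of
    abcd, with at most two if it lies in none of the four sets. Moreover if z
    lies in S_a then no neighbour of the pair az lies in any of the four sets, so
    d(az) is at most the density delta of the rest. With these constraints the
    inequality follows from tangent lines (AM-GM) at the balanced 4-partite
    configuration; for delta >= 1/5, or if some d is below 1/5, there is enough
    room for cruder estimates. *)

(** * The inequality for a single copy of K_4 *)

Section Ineq.
Variable R : realFieldType.
Implicit Types x y z d s : R.

(* The slope 3 is the largest one for which [ordering_sum_strong] holds to first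
   order in [dl]. *)
Definition cut x : R := if x < 1/5 then 3 * x else 1.

Lemma cut_le1 x : cut x <= 1.
Proof. by rewrite /cut; case: (ltP x) => ?; lra. Qed.

Lemma cut_ge0 x : 0 <= x -> 0 <= cut x.
Proof. by move=> x0; rewrite /cut; case: (ltP x) => ?; lra. Qed.

Lemma cut_gt0 x : 0 < x -> 0 < cut x.
Proof. by move=> x0; rewrite /cut; case: (ltP x) => ?; lra. Qed.

(** Tangent plane of [1 / (x * y * z)] at [(1, 1, 1)]. By AM-GM it reduces to
    [(4 - t) * t ^ 3 <= 27] for the sum [t]; rescaling the variables moves the point of tangency. *)
Lemma inv_prod3_ge x y z : 0 < x -> 0 < y -> 0 < z ->
  4 - x - y - z <= (x * y * z)^-1.
Proof.
move=> x0 y0 z0; have p0 : 0 < x * y * z by rewrite !mulr_gt0.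
rewrite -[leRHS]mul1r ler_pdivlMr //.
set t := x + y + z.
have -> : 4 - x - y - z = 4 - t by rewrite /t; ring.
have [t4|t4] := leP 4 t.
  by apply: (@le_trans _ _ 0) => //; rewrite mulr_le0_ge0 ?subr_le0 // ltW.
have amgm : 27 * (x * y * z) <= t ^+ 3.
  rewrite /t; have := mulr_ge0 (ltW x0) (sqr_ge0 (y - z)).
  have := mulr_ge0 (ltW y0) (sqr_ge0 (x - z)).
  have := mulr_ge0 (ltW z0) (sqr_ge0 (x - y)).
  have : 0 <= (x + y + z) * ((x - y) ^+ 2 + (y - z) ^+ 2 + (x - z) ^+ 2).
    by rewrite mulr_ge0 ?addr_ge0 ?sqr_ge0 // ltW.
  nra.
have t0 : 0 < t by rewrite /t !addr_gt0.
have : (4 - t) * t ^+ 3 <= 27.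
  (* The product equals [27 - (4 - t) * t ^ 3]. *)
  have : 0 <= (t - 3) ^+ 2 * ((t + 1) ^+ 2 + 2) by rewrite mulr_ge0 ?sqr_ge0 ?addr_ge0 ?sqr_ge0.
  nra.
have : (4 - t) * (27 * (x * y * z)) <= (4 - t) * t ^+ 3.
  by rewrite ler_wpM2l //; lra.
nra.
Qed.

Lemma inv_prod2_ge x y : 0 < x -> 0 < y -> 3 - x - y <= (x * y)^-1.
Proof.
move=> x0 y0; have := inv_prod3_ge x0 y0 (@ltr01 R); rewrite mulr1; lra.
Qed.

Definition cut_quo d := cut d / d.

Lemma cut_quo_strong d : 1/5 <= d -> cut_quo d = d^-1.
Proof. by move=> d5; rewrite /cut_quo /cut ltNge d5 /= mul1r. Qed.

Lemma cut_quo_weak d : 0 < d -> d < 1/5 -> cut_quo d = 3.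
Proof. by move=> d0 d5; rewrite /cut_quo /cut d5 mulfK // gt_eqF. Qed.

(** The line is tangent to [1 / d] at [d = 2/3], and its intercept is the constant value 3 that
    [cut_quo] takes on small [d]. *)
Lemma cut_quo_ge_linear d : 0 < d -> 3 - 9 / 4 * d <= cut_quo d.
Proof.
move=> d0; have [d5|d5] := ltP d (1/5); first by rewrite cut_quo_weak //; lra.
rewrite cut_quo_strong // -[leRHS]mul1r ler_pdivlMr //.
have := sqr_ge0 (3 / 2 * d - 1); nra.
Qed.

Lemma cut_quo_ge1 d : 0 < d -> d <= 1 -> 1 <= cut_quo d.
Proof.
move=> d0 d1; have [d5|d5] := ltP d (1/5); first by rewrite cut_quo_weak //; lra.
by rewrite cut_quo_strong // invf_ge1.
Qed.

(* Cauchy-Schwarz together with [13 ^ 2 <= 10 * 17 <= u * v]. *)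
Lemma weighted_inv_ge u v x y : 10 <= u -> 10 <= v -> 27 <= u + v ->
  0 < x -> 0 < y -> x + y <= 1/5 -> 256 <= u / x + v / y.
Proof.
move=> u0 v0 uv x0 y0 xy.
rewrite addf_div ?gt_eqF // ler_pdivlMr ?mulr_gt0 //.
have uv169 : 169 <= u * v by nra.
have cross : 26 * (x * y) <= u * y ^+ 2 + v * x ^+ 2.
  have u1 : 0 < u by lra.
  rewrite -(ler_pM2l u1).
  have := sqr_ge0 (u * y - 13 * x).
  have : 169 * x ^+ 2 <= u * v * x ^+ 2 by rewrite ler_wpM2r ?sqr_ge0.
  nra.
(* Multiplied out, the left side is at least [(26 + 27) * (x * y)], so [u * y + v * x] is at least
   [265 * (x * y)]. *)
have : (u * y + v * x) * (x + y) <= (u * y + v * x) * (1/5).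
  by rewrite ler_wpM2l // addr_ge0 // mulr_ge0 //; lra.
have : 27 * (x * y) <= (u + v) * (x * y) by rewrite ler_wpM2r // mulr_ge0 // ltW.
have xy0 : 0 < x * y by rewrite mulr_gt0.
nra.
Qed.

Lemma pair_term_ge (H1 H2 q s1 s2 : R) : 0 < H1 <= 1 -> 0 < H2 <= 1 ->
  0 <= q -> 0 < s1 -> 0 < s2 ->
  2 * q * (s1^-1 + s2^-1) <= q * (H1^-1 + H2^-1) * (s1^-1 + s2^-1).
Proof.
move=> /andP[H10 H11] /andP[H20 H21] q0 s10 s20.
rewrite [2 * q]mulrC ler_wpM2r ?addr_ge0 ?invr_ge0 ?(ltW s10) ?(ltW s20) //.
have h1 : 1 <= H1^-1 by rewrite invf_ge1.
have h2 : 1 <= H2^-1 by rewrite invf_ge1.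
by rewrite ler_wpM2l //; lra.
Qed.

(** Total weight of the four orderings whose first two vertices are a given pair; [s1] and [s2]
    belong to the two triples through that pair. *)
Definition pair_term (H1 H2 d s1 s2 : R) :=
  cut_quo d * (H1^-1 + H2^-1) * (s1^-1 + s2^-1).

(** All 24 orderings, grouped by leading pair. Each [si] belongs to the triple that omits vertex
    [i]. *)
Definition ordering_sum (H1 H2 H3 H4 d12 d13 d14 d23 d24 d34 s1 s2 s3 s4 : R) :=
  pair_term H1 H2 d12 s3 s4 + pair_term H1 H3 d13 s2 s4 +
  pair_term H1 H4 d14 s2 s3 + pair_term H2 H3 d23 s1 s4 +
  pair_term H2 H4 d24 s1 s3 + pair_term H3 H4 d34 s1 s2.

(** A small [d12] forces [s3 + s4 < 1/5], so the terms in [1 / s3] and [1 / s4] suffice, even with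
    every [H] replaced by 1. *)
Lemma ordering_sum_weak H1 H2 H3 H4 d12 d13 d14 d23 d24 d34 s1 s2 s3 s4 :
  0 < H1 <= 1 -> 0 < H2 <= 1 -> 0 < H3 <= 1 -> 0 < H4 <= 1 ->
  0 < s1 -> 0 < s2 -> 0 < s3 -> 0 < s4 ->
  0 < d13 -> 0 < d14 -> 0 < d23 -> 0 < d24 -> 0 < d34 ->
  s3 + s4 <= d12 -> d13 + d24 <= 1 -> d14 + d23 <= 1 -> d12 < 1/5 ->
  256 <= ordering_sum H1 H2 H3 H4 d12 d13 d14 d23 d24 d34 s1 s2 s3 s4.
Proof.
move=> H1p H2p H3p H4p s10 s20 s30 s40 d130 d140 d230 d240 d340 sd d1324 d1423 dw.
have d120 : 0 < d12 by lra.
have quo0 d : 0 < d -> 0 <= cut_quo d.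
  by move=> d0; rewrite /cut_quo divr_ge0 ?cut_ge0 // ltW.
rewrite /ordering_sum.
have := pair_term_ge H1p H2p (quo0 _ d120) s30 s40.
have := pair_term_ge H1p H3p (quo0 _ d130) s20 s40.
have := pair_term_ge H1p H4p (quo0 _ d140) s20 s30.
have := pair_term_ge H2p H3p (quo0 _ d230) s10 s40.
have := pair_term_ge H2p H4p (quo0 _ d240) s10 s30.
have := pair_term_ge H3p H4p (quo0 _ d340) s10 s20.
rewrite -!/(pair_term _ _ _ _ _) (cut_quo_weak d120 dw).
have q13 := cut_quo_ge_linear d130; have q14 := cut_quo_ge_linear d140.
have q23 := cut_quo_ge_linear d230; have q24 := cut_quo_ge_linear d240.
have l13 : 1 <= cut_quo d13 by apply: cut_quo_ge1 => //; lra.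
have l14 : 1 <= cut_quo d14 by apply: cut_quo_ge1 => //; lra.
have l23 : 1 <= cut_quo d23 by apply: cut_quo_ge1 => //; lra.
have l24 : 1 <= cut_quo d24 by apply: cut_quo_ge1 => //; lra.
(* Each coefficient is at least 10 as every [cut_quo] is at least 1. By the linear bounds their sum
   is at least [12 + 2 * (12 - 9/4 * 2) = 27], since [d13 + d24] and [d14 + d23] are at most 1. *)
have main : 256 <= (6 + 2 * cut_quo d13 + 2 * cut_quo d23) / s4
                 + (6 + 2 * cut_quo d14 + 2 * cut_quo d24) / s3.
  by apply: weighted_inv_ge => //; lra.
have i1 : 0 < s1^-1 by rewrite invr_gt0.
have i2 : 0 < s2^-1 by rewrite invr_gt0.
have n0 d s : 0 < d -> 0 < s^-1 -> 0 <= cut_quo d * s^-1.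
  by move=> d0 s0; rewrite mulr_ge0 ?quo0 // ltW.
have := n0 _ _ d130 i2; have := n0 _ _ d140 i2; have := n0 _ _ d230 i1.
have := n0 _ _ d240 i1; have := n0 _ _ d340 i1; have := n0 _ _ d340 i2.
move: main; lra.
Qed.

Lemma ordering_sum_strong H1 H2 H3 H4 d12 d13 d14 d23 d24 d34 s1 s2 s3 s4 (dl : R) :
  0 < H1 <= 1 -> 0 < H2 <= 1 -> 0 < H3 <= 1 -> 0 < H4 <= 1 ->
  0 < s1 -> 0 < s2 -> 0 < s3 -> 0 < s4 -> s1 + s2 + s3 + s4 = 1 - dl ->
  d12 + d13 + d14 + d23 + d24 + d34 <= 3 - dl ->
  (dl < 1/5 -> [/\ H1 <= 1 - s1 + 3 * dl * s1, H2 <= 1 - s2 + 3 * dl * s2,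
     H3 <= 1 - s3 + 3 * dl * s3 & H4 <= 1 - s4 + 3 * dl * s4]) ->
  1/5 <= d12 -> 1/5 <= d13 -> 1/5 <= d14 -> 1/5 <= d23 -> 1/5 <= d24 -> 1/5 <= d34 ->
  256 <= ordering_sum H1 H2 H3 H4 d12 d13 d14 d23 d24 d34 s1 s2 s3 s4.
Proof.
move=> /andP[H10 H11] /andP[H20 H21] /andP[H30 H31] /andP[H40 H41].
move=> s10 s20 s30 s40 ssum dsum Hle d12s d13s d14s d23s d24s d34s.
rewrite /ordering_sum /pair_term !cut_quo_strong // !mulrDr !mulrDl.
have [dl5|dl5] := ltP dl (1/5).
  have [h1 h2 h3 h4] := Hle dl5.
  (* Tangent at [H = 3/4], [d = 1/2], [s = 1/4], the balanced 4-partite values; [32/3] is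
     [4/3 * 2 * 4]. *)
  have t H d s : 0 < H -> 1/5 <= d -> 0 < s ->
      32 / 3 * (4 - 4 / 3 * H - 2 * d - 4 * s) <= d^-1 * H^-1 * s^-1.
    move=> H0 d5 s0; have d0 : 0 < d by lra.
    have -> : d^-1 * H^-1 * s^-1 = 32 / 3 * (4 / 3 * H * (2 * d) * (4 * s))^-1.
      by field; rewrite !gt_eqF.
    by rewrite ler_wpM2l ?inv_prod3_ge ?mulr_gt0 //; lra.
  have := t _ _ _ H10 d12s s30; have := t _ _ _ H10 d12s s40.
  have := t _ _ _ H20 d12s s30; have := t _ _ _ H20 d12s s40.
  have := t _ _ _ H10 d13s s20; have := t _ _ _ H10 d13s s40.
  have := t _ _ _ H30 d13s s20; have := t _ _ _ H30 d13s s40.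
  have := t _ _ _ H10 d14s s20; have := t _ _ _ H10 d14s s30.
  have := t _ _ _ H40 d14s s20; have := t _ _ _ H40 d14s s30.
  have := t _ _ _ H20 d23s s10; have := t _ _ _ H20 d23s s40.
  have := t _ _ _ H30 d23s s10; have := t _ _ _ H30 d23s s40.
  have := t _ _ _ H20 d24s s10; have := t _ _ _ H20 d24s s30.
  have := t _ _ _ H40 d24s s10; have := t _ _ _ H40 d24s s30.
  have := t _ _ _ H30 d34s s10; have := t _ _ _ H30 d34s s20.
  have := t _ _ _ H40 d34s s10; have := t _ _ _ H40 d34s s20.
  have Hsum : H1 + H2 + H3 + H4 <= 4 - (1 - dl) + 3 * (dl - dl ^+ 2).
    have -> : 3 * (dl - dl ^+ 2) = 3 * dl * (s1 + s2 + s3 + s4) by rewrite ssum; ring.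
    rewrite -ssum; lra.
  (* In the sum of the 24 tangents the terms linear in [dl] cancel, which leaves the lower bound
     [256 + 256 * dl ^ 2]. *)
  have := sqr_ge0 dl.
  clear - Hsum ssum dsum.
  set a := dl ^+ 2 in Hsum *. lra.
(* Now [H <= 1] is enough. The tangent point [d = 7/15], [s = 1/5] comes from dividing the bounds
   [14/5] and [4/5] on the two sums at [dl = 1/5] evenly; the total is at least [1800/7 > 256]. *)
have t H d s : 0 < H -> H <= 1 -> 1/5 <= d -> 0 < s ->
    75 / 7 * (3 - 15 / 7 * d - 5 * s) <= d^-1 * H^-1 * s^-1.
  move=> H0 H1' d5 s0; have d0 : 0 < d by lra.
  have -> : d^-1 * H^-1 * s^-1 = 75 / 7 * (15 / 7 * d * (5 * s))^-1 * H^-1.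
    by field; rewrite !gt_eqF.
  apply: (@le_trans _ _ (75 / 7 * (15 / 7 * d * (5 * s))^-1)).
    by rewrite ler_wpM2l ?inv_prod2_ge ?mulr_gt0 //; lra.
  rewrite ler_peMr ?invf_ge1 // mulr_ge0 ?invr_ge0 ?mulr_ge0 //; lra.
have := t _ _ _ H10 H11 d12s s30; have := t _ _ _ H10 H11 d12s s40.
have := t _ _ _ H20 H21 d12s s30; have := t _ _ _ H20 H21 d12s s40.
have := t _ _ _ H10 H11 d13s s20; have := t _ _ _ H10 H11 d13s s40.
have := t _ _ _ H30 H31 d13s s20; have := t _ _ _ H30 H31 d13s s40.
have := t _ _ _ H10 H11 d14s s20; have := t _ _ _ H10 H11 d14s s30.
have := t _ _ _ H40 H41 d14s s20; have := t _ _ _ H40 H41 d14s s30.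
have := t _ _ _ H20 H21 d23s s10; have := t _ _ _ H20 H21 d23s s40.
have := t _ _ _ H30 H31 d23s s10; have := t _ _ _ H30 H31 d23s s40.
have := t _ _ _ H20 H21 d24s s10; have := t _ _ _ H20 H21 d24s s30.
have := t _ _ _ H40 H41 d24s s10; have := t _ _ _ H40 H41 d24s s30.
have := t _ _ _ H30 H31 d34s s10; have := t _ _ _ H30 H31 d34s s20.
have := t _ _ _ H40 H41 d34s s10; have := t _ _ _ H40 H41 d34s s20.
clear - ssum dsum dl5.
lra.
Qed.

(** If some pair density is below [1/5], relabelling the four vertices turns that pair into the
    first one of [ordering_sum_weak]. *)
Lemma ordering_sum_ge H1 H2 H3 H4 d12 d13 d14 d23 d24 d34 s1 s2 s3 s4 (dl : R) :
  0 < H1 <= 1 -> 0 < H2 <= 1 -> 0 < H3 <= 1 -> 0 < H4 <= 1 ->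
  0 < s1 -> 0 < s2 -> 0 < s3 -> 0 < s4 -> s1 + s2 + s3 + s4 = 1 - dl ->
  [/\ s3 + s4 <= d12, s2 + s4 <= d13 & s2 + s3 <= d14] ->
  [/\ s1 + s4 <= d23, s1 + s3 <= d24 & s1 + s2 <= d34] ->
  [/\ d12 + d34 <= 1, d13 + d24 <= 1 & d14 + d23 <= 1] ->
  d12 + d13 + d14 + d23 + d24 + d34 <= 3 - dl ->
  (dl < 1/5 -> [/\ H1 <= 1 - s1 + 3 * dl * s1, H2 <= 1 - s2 + 3 * dl * s2,
     H3 <= 1 - s3 + 3 * dl * s3 & H4 <= 1 - s4 + 3 * dl * s4]) ->
  256 <= ordering_sum H1 H2 H3 H4 d12 d13 d14 d23 d24 d34 s1 s2 s3 s4.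
Proof.
move=> H1p H2p H3p H4p s10 s20 s30 s40 ssum [sd12 sd13 sd14] [sd23 sd24 sd34].
move=> [dd1 dd2 dd3] dsum Hle.
have [w|d12s] := ltP d12 (1/5); first by apply: ordering_sum_weak => //; lra.
have [w|d13s] := ltP d13 (1/5).
  have := @ordering_sum_weak H1 H3 H2 H4 d13 d12 d14 d23 d34 d24 s1 s3 s2 s4.
  rewrite /ordering_sum /pair_term; lra.
have [w|d14s] := ltP d14 (1/5).
  have := @ordering_sum_weak H1 H4 H2 H3 d14 d12 d13 d24 d34 d23 s1 s4 s2 s3.
  rewrite /ordering_sum /pair_term; lra.
have [w|d23s] := ltP d23 (1/5).
  have := @ordering_sum_weak H2 H3 H1 H4 d23 d12 d24 d13 d34 d14 s2 s3 s1 s4.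
  rewrite /ordering_sum /pair_term; lra.
have [w|d24s] := ltP d24 (1/5).
  have := @ordering_sum_weak H2 H4 H1 H3 d24 d12 d23 d14 d34 d13 s2 s4 s1 s3.
  rewrite /ordering_sum /pair_term; lra.
have [w|d34s] := ltP d34 (1/5).
  have := @ordering_sum_weak H3 H4 H1 H2 d34 d13 d23 d14 d24 d12 s3 s4 s1 s2.
  rewrite /ordering_sum /pair_term; lra.
exact: (ordering_sum_strong H1p H2p H3p H4p s10 s20 s30 s40 ssum dsum Hle).
Qed.

End Ineq.

(** * Triple systems with independent neighbourhoods *)

Section TripleSystem.
Variables (T : finType) (e : T -> T -> T -> bool).
Hypothesis eC12 : forall a b c, e a b c = e b a c.
Hypothesis eC23 : forall a b c, e a b c = e a c b.
Hypothesis e_free : forall a b x y z,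
  e a b x -> e a b y -> e a b z -> e x y z -> False.

Definition clique4 a b c d := [&& e a b c, e a b d, e a c d & e b c d].
Definition nbr a b := [set v | e v a b].
Definition ext a b c := [set v | [&& e v a b, e v a c & e v b c]].

(** One alternative for each of the six orders of a triple. *)
Ltac eperm :=
  solve [ assumption | rewrite eC12; assumption | rewrite eC23; assumption
        | rewrite eC12 eC23; assumption | rewrite eC23 eC12; assumption
        | rewrite eC12 eC23 eC12; assumption ].

Lemma clique4C12 a b c d : clique4 a b c d = clique4 b a c d.
Proof. by rewrite /clique4 !(eC12 a b) [e a c d && _]andbC. Qed.

Lemma clique4C23 a b c d : clique4 a b c d = clique4 a c b d.
Proof. by rewrite /clique4 (eC23 a b c) (eC12 b c) [e a b d && _]andbCA. Qed.

Lemma clique4C34 a b c d : clique4 a b c d = clique4 a b d c.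
Proof. by rewrite /clique4 (eC23 a c) (eC23 b c) andbCA. Qed.

Lemma nbrC a b : nbr a b = nbr b a.
Proof. by apply/finset.setP => v; rewrite !inE eC23. Qed.

Lemma extC12 a b c : ext a b c = ext b a c.
Proof. by apply/finset.setP => v; rewrite !inE (eC23 v a b) [e v a c && _]andbC. Qed.

Lemma extC23 a b c : ext a b c = ext a c b.
Proof. by apply/finset.setP => v; rewrite !inE (eC23 v b c) andbCA. Qed.

(** The pair [ab] would have the edge [cdv] inside its neighbourhood. *)
Lemma link_opposite a b c d v : clique4 a b c d -> e v a b -> e v c d -> False.
Proof.
move=> /and4P[abc abd acd bcd] vab vcd.
by apply: (@e_free a b c d v); eperm.
Qed.

(** The pair [va] would have the edge [bcd] inside its neighbourhood. *)
Lemma link_star a b c d v : clique4 a b c d ->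
  e v a b -> e v a c -> e v a d -> False.
Proof.
move=> /and4P[abc abd acd bcd] vab vac vad.
by apply: (@e_free v a b c d); eperm.
Qed.

(** The link of a vertex on [abcd] has no perfect matching and no vertex of degree 3, so it is a
    triangle or has at most two edges. Stating this on six booleans turns the counting lemmas below
    into finite checks, one vertex at a time. *)
Variant link_spec : bool -> bool -> bool -> bool -> bool -> bool ->
  Prop :=
  LinkSpec xab xac xad xbc xbd xcd of
    ~~ (xab && xcd) & ~~ (xac && xbd) & ~~ (xad && xbc)
  & ~~ [&& xab, xac & xad] & ~~ [&& xab, xbc & xbd]
  & ~~ [&& xac, xbc & xcd] & ~~ [&& xad, xbd & xcd]
  : link_spec xab xac xad xbc xbd xcd.

Lemma linkP a b c d v : clique4 a b c d ->
  link_spec (e v a b) (e v a c) (e v a d) (e v b c) (e v b d) (e v c d).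
Proof.
move=> K.
have Kb : clique4 b a c d by rewrite clique4C12.
have Kc : clique4 c a b d by rewrite clique4C12 clique4C23.
have Kd : clique4 d a b c by rewrite clique4C12 clique4C23 clique4C34.
have Kac : clique4 a c b d by rewrite clique4C23.
have Kad : clique4 a d b c by rewrite clique4C23 clique4C34.
split; apply/negP.
- by case/andP=> x y; apply: (link_opposite K x y).
- by case/andP=> x y; apply: (link_opposite Kac x y).
- by case/andP=> x y; apply: (link_opposite Kad x y).
- by case/and3P=> x y z; apply: (link_star K x y z).
- by case/and3P=> x y z; rewrite eC23 in x; apply: (link_star Kb x y z).
- by case/and3P=> x y z; rewrite eC23 in x; rewrite eC23 in y; apply: (link_star Kc x y z).
- case/and3P=> x y z; rewrite eC23 in x; rewrite eC23 in y; rewrite eC23 in z.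
  by apply: (link_star Kd x y z).
Qed.

Lemma card_sum_mem (A : {set T}) : #|A| = (\sum_v (v \in A))%N.
Proof. by rewrite -sum1_card big_mkcond. Qed.

Section Clique.
Variables (a b c d : T).
Hypothesis K : clique4 a b c d.

Lemma card_nbr_opposite : (#|nbr a b| + #|nbr c d| <= #|T|)%N.
Proof.
rewrite -[#|T|]sum1_card !card_sum_mem -big_split /=.
apply: leq_sum => v _; rewrite !inE; move: (linkP v K).
by case=> [] [] [] [] [] [] [].
Qed.

Lemma card_ext_nbr : (#|ext a b c| + #|ext a b d| <= #|nbr a b|)%N.
Proof.
rewrite !card_sum_mem -big_split /=.
apply: leq_sum => v _; rewrite !inE; move: (linkP v K).
by case=> [] [] [] [] [] [] [].
Qed.

(** A link has at most two edges, or else it is a triangle and the vertex lies in one of the four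
    sets [ext]. *)
Lemma card_nbr_sum :
  (#|nbr a b| + #|nbr a c| + #|nbr a d| + #|nbr b c| + #|nbr b d| + #|nbr c d|
     <= #|T| + #|T| + (#|ext b c d| + #|ext a c d| + #|ext a b d| + #|ext a b c|))%N.
Proof.
rewrite -[#|T|]sum1_card !card_sum_mem -!big_split /=.
apply: leq_sum => v _; rewrite !inE; move: (linkP v K).
by case=> [] [] [] [] [] [] [].
Qed.

(* If [z] and [a] both extend the triple [bcd], then the common neighbours of
   [a] and [z] extend no triple of [abcd]. *)
Lemma card_nbr_ext z : z \in ext b c d ->
  (#|nbr a z| + (#|ext b c d| + #|ext a c d| + #|ext a b d| + #|ext a b c|)
     <= #|T|)%N.
Proof.
rewrite inE => /and3P[zbc zbd zcd]; move: (K) => /and4P[abc abd acd bcd].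
rewrite -[#|T|]sum1_card !card_sum_mem -!big_split /=.
apply: leq_sum => u _; rewrite !inE.
have [uaz|_] := boolP (e u a z); last first.
  by move: (linkP u K); case=> [] [] [] [] [] [] [].
(* The pair [bc] would have the edge [azu] inside its neighbourhood. In the other three cases the
   pair is [au], whose neighbours would include [z] and two of [b], [c], [d]; these form an edge
   because [z] extends [bcd]. *)
have nbc : ~~ e u b c by apply/negP => ubc; apply: (@e_free b c a z u); eperm.
have ncd : ~~ (e u a c && e u a d).
  by apply/negP => /andP[uac uad]; apply: (@e_free a u z c d); eperm.
have nbd : ~~ (e u a b && e u a d).
  by apply/negP => /andP[uac uad]; apply: (@e_free a u z b d); eperm.
have nab : ~~ (e u a b && e u a c).
  by apply/negP => /andP[uac uad]; apply: (@e_free a u z b c); eperm.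
move: nbc ncd nbd nab.
by case: (e u a b); case: (e u a c); case: (e u a d); case: (e u b c).
Qed.

Lemma mem_ext_clique : a \in ext b c d.
Proof. by case/and4P: K => abc abd acd _; rewrite inE abc abd acd. Qed.

Lemma mem_nbr_clique : c \in nbr a b.
Proof. by case/and4P: K => abc _ _ _; rewrite inE; eperm. Qed.

End Clique.

(** * Weights and sums over ordered copies of K_4 *)

Variable R : realFieldType.

Definition nbr_dens a b : R := #|nbr a b|%:R / #|T|%:R.
Definition ext_dens a b c : R := #|ext a b c|%:R / #|T|%:R.
Definition cut_dens a : R := (\sum_z cut (nbr_dens a z)) / #|T|%:R.
(** The denominators are arranged so that summing over the fourth, third and second vertex of a copy
    cancels [ext_dens], [nbr_dens] and [cut_dens] in turn. *)
Definition weight a b c : R := cut_quo (nbr_dens a b) / cut_dens a / ext_dens a b c.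

Definition clique_sum (f : T -> T -> T -> T -> R) : R :=
  \sum_a \sum_b \sum_c \sum_(d | clique4 a b c d) f a b c d.

Lemma clique_sumC12 f : clique_sum f = clique_sum (fun a b c d => f b a c d).
Proof.
rewrite /clique_sum exchange_big; apply: eq_bigr => a _; apply: eq_bigr => b _.
by apply: eq_bigr => c _; apply: eq_bigl => d; rewrite clique4C12.
Qed.

Lemma clique_sumC23 f : clique_sum f = clique_sum (fun a b c d => f a c b d).
Proof.
rewrite /clique_sum; apply: eq_bigr => a _; rewrite exchange_big.
apply: eq_bigr => b _; apply: eq_bigr => c _.
by apply: eq_bigl => d; rewrite clique4C23.
Qed.

Lemma clique_sumC34 f : clique_sum f = clique_sum (fun a b c d => f a b d c).
Proof.
rewrite /clique_sum; apply: eq_bigr => a _; apply: eq_bigr => b _.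
rewrite (exchange_big_dep xpredT) //=; apply: eq_bigr => c _.
by apply: eq_bigl => d; rewrite clique4C34.
Qed.

Lemma clique_sumD f g :
  clique_sum (fun a b c d => f a b c d + g a b c d) = clique_sum f + clique_sum g.
Proof.
rewrite /clique_sum -big_split; apply: eq_bigr => a _.
rewrite -big_split; apply: eq_bigr => b _.
by rewrite -big_split; apply: eq_bigr => c _; rewrite -big_split.
Qed.

(** The orderings are built by choosing the first vertex, then the second, and so on, so that
    adjacent transpositions are enough to compare the sums. *)
Definition sum_last2 (f : T -> T -> T -> T -> R) a b c d := f a b c d + f a b d c.
Definition sum_last3 (f : T -> T -> T -> T -> R) a b c d :=
  sum_last2 f a b c d + sum_last2 f a c b d + sum_last2 f a d b c.
Definition sum_all4 (f : T -> T -> T -> T -> R) a b c d :=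
  sum_last3 f a b c d + sum_last3 f b a c d + sum_last3 f c a b d +
  sum_last3 f d a b c.

Lemma clique_sum_all4 f : clique_sum (sum_all4 f) = 24 * clique_sum f.
Proof.
have h2 : clique_sum (sum_last2 f) = 2 * clique_sum f.
  by rewrite [LHS]clique_sumD -clique_sumC34 mulr2n mulrDl mul1r.
have h3 : clique_sum (sum_last3 f) = 3 * clique_sum (sum_last2 f).
  rewrite [LHS]clique_sumD clique_sumD.
  rewrite -(clique_sumC34 (fun a b c d => sum_last2 f a c b d)) -clique_sumC23.
  ring.
have hb : clique_sum (fun a b c d => sum_last3 f b a c d) =
    clique_sum (sum_last3 f) by rewrite [RHS]clique_sumC12.
have hc : clique_sum (fun a b c d => sum_last3 f c a b d) =
    clique_sum (sum_last3 f) by rewrite -hb [RHS]clique_sumC23.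
have hd : clique_sum (fun a b c d => sum_last3 f d a b c) =
    clique_sum (sum_last3 f) by rewrite -hc [RHS]clique_sumC34.
rewrite [LHS]clique_sumD hd clique_sumD hc clique_sumD hb.
by rewrite h3 h2; ring.
Qed.

Lemma nbr_dens_ge0 a b : 0 <= nbr_dens a b.
Proof. by rewrite divr_ge0 ?ler0n. Qed.

Lemma ext_dens_ge0 a b c : 0 <= ext_dens a b c.
Proof. by rewrite divr_ge0 ?ler0n. Qed.

Lemma cut_dens_ge0 a : 0 <= cut_dens a.
Proof.
by rewrite divr_ge0 ?ler0n // sumr_ge0 // => z _; rewrite cut_ge0 ?nbr_dens_ge0.
Qed.

Lemma cut_quo_ge0 (x : R) : 0 <= x -> 0 <= cut_quo x.
Proof. by move=> x0; rewrite divr_ge0 ?cut_ge0. Qed.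

(** The cancellation step of the telescoping. For [x != 0] it is an equality; for [x = 0] the left
    side vanishes. *)
Lemma mulr_cancel_le (x y m : R) : 0 <= y -> 0 <= m -> x * (y / (x / m)) <= m * y.
Proof.
move=> y0 m0; have [->|x0] := eqVneq x 0; first by rewrite mul0r mulr_ge0.
by rewrite invf_div; have -> : x * (y * (m / x)) = m * y by field.
Qed.

(** The last vertex ranges over a subset of [ext a b c], which cancels [ext_dens a b c] up to a
    factor [#|T|]. *)
Lemma sum_weight_last a b c :
  \sum_(d | clique4 a b c d) weight a b c
    <= if c \in nbr a b then #|T|%:R * (cut_quo (nbr_dens a b) / cut_dens a) else 0.
Proof.
have w0 : 0 <= cut_quo (nbr_dens a b) / cut_dens a.
  by rewrite divr_ge0 ?cut_dens_ge0 ?cut_quo_ge0 ?nbr_dens_ge0.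
case: ifP => abc; last first.
  rewrite big1 // => d /and4P[abc' _ _ _]; move: abc.
  by rewrite inE eC12 eC23 abc'.
apply: le_trans (mulr_cancel_le #|ext a b c|%:R w0 (ler0n _ _)).
rewrite sumr_const mulr_natl; apply: ler_wpMn2l; first by rewrite divr_ge0 ?ext_dens_ge0.
apply: subset_leq_card; apply/fintype.subsetP => d /and4P[abc' abd acd bcd].
by rewrite inE; apply/and3P; split; eperm.
Qed.

Lemma clique_sum_weight_le :
  clique_sum (fun a b c _ => weight a b c) <= #|T|%:R ^+ 4.
Proof.
have n0 : 0 <= #|T|%:R :> R by rewrite ler0n.
(* The sum over [c] has [#|nbr a b|] terms, which cancels the denominator of [cut_quo]. *)
have step2 a b : \sum_c \sum_(d | clique4 a b c d) weight a b c
    <= #|T|%:R ^+ 2 * (cut (nbr_dens a b) / cut_dens a).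
  apply: le_trans (ler_sum _ (fun c _ => sum_weight_last a b c)) _.
  rewrite -big_mkcond sumr_const -[leLHS]mulr_natl.
  have -> : #|nbr a b|%:R * (#|T|%:R * (cut_quo (nbr_dens a b) / cut_dens a)) =
      #|T|%:R * (#|nbr a b|%:R * (cut (nbr_dens a b) / cut_dens a / nbr_dens a b)).
    by rewrite /cut_quo; ring.
  rewrite expr2 -[leRHS]mulrA ler_wpM2l // mulr_cancel_le //.
  by rewrite divr_ge0 ?cut_dens_ge0 ?cut_ge0 ?nbr_dens_ge0.
(* The sum of [cut (nbr_dens a b)] over [b] is the numerator of [cut_dens a]. *)
have step1 a : \sum_b \sum_c \sum_(d | clique4 a b c d) weight a b c
    <= #|T|%:R ^+ 3.
  apply: le_trans (ler_sum _ (fun b _ => step2 a b)) _.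
  rewrite -mulr_sumr -mulr_suml [leRHS]exprSr ler_wpM2l ?exprn_ge0 //.
  have := @mulr_cancel_le (\sum_b cut (nbr_dens a b)) 1 _ ler01 n0.
  by rewrite mulr1 div1r.
apply: le_trans (ler_sum _ (fun a _ => step1 a)) _.
by rewrite sumr_const -[leLHS]mulr_natr -exprSr.
Qed.

Lemma nbr_densC a b : nbr_dens a b = nbr_dens b a.
Proof. by rewrite /nbr_dens nbrC. Qed.

Lemma ext_densC12 a b c : ext_dens a b c = ext_dens b a c.
Proof. by rewrite /ext_dens extC12. Qed.

Lemma ext_densC23 a b c : ext_dens a b c = ext_dens a c b.
Proof. by rewrite /ext_dens extC23. Qed.

(** * Constraints on the densities around one copy of K_4 *)

Section CliqueDensities.
Variables (a b c d : T).
Hypothesis K : clique4 a b c d.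

Let T_gt0 : 0 < #|T|%:R :> R.
Proof. by rewrite ltr0n; apply/card_gt0P; exists a. Qed.

Lemma nbr_dens_opposite : nbr_dens a b + nbr_dens c d <= 1.
Proof.
rewrite /nbr_dens -mulrDl -natrD ler_pdivrMr // mul1r ler_nat.
exact: card_nbr_opposite K.
Qed.

Lemma ext_dens_ndeg : ext_dens a b c + ext_dens a b d <= nbr_dens a b.
Proof.
rewrite /nbr_dens /ext_dens -mulrDl -natrD ler_pM2r ?invr_gt0 // ler_nat.
exact: card_ext_nbr K.
Qed.

Lemma nbr_dens_sum :
  nbr_dens a b + nbr_dens a c + nbr_dens a d + nbr_dens b c + nbr_dens b d + nbr_dens c d
    <= 2 + (ext_dens b c d + ext_dens a c d + ext_dens a b d + ext_dens a b c).
Proof.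
rewrite -(ler_pM2r T_gt0) /nbr_dens /ext_dens !mulrDl !divfK ?gt_eqF //.
by have := card_nbr_sum K; rewrite -(ler_nat R) !natrD; lra.
Qed.

Lemma nbr_dens_ext z : z \in ext b c d ->
  nbr_dens a z <= 1 - (ext_dens b c d + ext_dens a c d + ext_dens a b d + ext_dens a b c).
Proof.
move=> zE; rewrite lerBrDr /nbr_dens /ext_dens -!mulrDl -!natrD ler_pdivrMr // mul1r.
by rewrite ler_nat (card_nbr_ext K zE).
Qed.

Lemma ext_dens_gt0 : 0 < ext_dens b c d.
Proof.
rewrite divr_gt0 // ltr0n; apply/card_gt0P; exists a; exact: mem_ext_clique K.
Qed.

Lemma cut_dens_gt0_le1 : 0 < cut_dens a <= 1.
Proof.
have cg z : 0 <= cut (nbr_dens a z) by rewrite cut_ge0 ?nbr_dens_ge0.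
apply/andP; split.
  rewrite divr_gt0 // (bigD1 b) //= ltr_pwDl ?sumr_ge0 //.
  rewrite cut_gt0 // divr_gt0 // ltr0n; apply/card_gt0P; exists c.
  exact: mem_nbr_clique K.
rewrite ler_pdivrMr // mul1r -sum1_card natr_sum ler_sum // => z _.
exact: cut_le1.
Qed.

(** A vertex [z] of [ext b c d] has [nbr_dens a z <= dl < 1/5], so it contributes at most [3 * dl]
    to the average; any other contributes at most 1. *)
Lemma cut_dens_le (dl := 1 - (ext_dens b c d + ext_dens a c d + ext_dens a b d + ext_dens a b c)) :
  dl < 1/5 -> cut_dens a <= 1 - ext_dens b c d + 3 * dl * ext_dens b c d.
Proof.
move=> dl5; have dz z : z \in ext b c d -> nbr_dens a z <= dl by exact: nbr_dens_ext.
clearbody dl; rewrite ler_pdivrMr //.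
have -> : (1 - ext_dens b c d + 3 * dl * ext_dens b c d) * #|T|%:R =
    #|T|%:R - #|ext b c d|%:R + 3 * dl * #|ext b c d|%:R.
  by rewrite /ext_dens; field; rewrite gt_eqF.
rewrite -[#|T|]sum1_card [#|ext b c d|]card_sum_mem !natr_sum -sumrN mulr_sumr.
rewrite -!big_split /= ler_sum // => z _; case: (boolP (z \in _)) => zE /=.
  have := dz z zE; rewrite /cut ifT; first by lra.
  by apply: le_lt_trans dl5; apply: dz.
by have := cut_le1 (nbr_dens a z); lra.
Qed.

End CliqueDensities.

Lemma sum_all4_weight_ge a b c d : clique4 a b c d ->
  256 <= sum_all4 (fun a b c _ => weight a b c) a b c d.
Proof.
move=> K.
have Kb : clique4 b a c d by rewrite clique4C12.
have Kc : clique4 c a b d by rewrite clique4C12 clique4C23.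
have Kd : clique4 d a b c by rewrite clique4C12 clique4C23 clique4C34.
have Kac : clique4 a c b d by rewrite clique4C23.
have Kad : clique4 a d b c by rewrite clique4C23 clique4C34.
have Kbc : clique4 b c a d by rewrite clique4C23.
have Kbd : clique4 b d a c by rewrite clique4C23 clique4C34.
have Kcd : clique4 c d a b by rewrite clique4C23 clique4C34.
pose s1 := ext_dens b c d; pose s2 := ext_dens a c d.
pose s3 := ext_dens a b d; pose s4 := ext_dens a b c.
(* The tuples of equations [E1] to [E4] and [D] are rewrite rules that put the arguments of each
   symmetric density in a fixed order. *)
have E1 : (ext_dens b d c = s1) * (ext_dens c b d = s1) * (ext_dens c d b = s1)
        * (ext_dens d b c = s1) * (ext_dens d c b = s1).
  by rewrite /s1; do !split; rewrite ?(ext_densC23 d c b) ?(ext_densC12 d b c)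
    ?(ext_densC23 b d c) ?(ext_densC23 c d b) ?(ext_densC12 c b d).
have E2 : (ext_dens a d c = s2) * (ext_dens c a d = s2) * (ext_dens c d a = s2)
        * (ext_dens d a c = s2) * (ext_dens d c a = s2).
  by rewrite /s2; do !split; rewrite ?(ext_densC23 d c a) ?(ext_densC12 d a c)
    ?(ext_densC23 a d c) ?(ext_densC23 c d a) ?(ext_densC12 c a d).
have E3 : (ext_dens a d b = s3) * (ext_dens b a d = s3) * (ext_dens b d a = s3)
        * (ext_dens d a b = s3) * (ext_dens d b a = s3).
  by rewrite /s3; do !split; rewrite ?(ext_densC23 d b a) ?(ext_densC12 d a b)
    ?(ext_densC23 a d b) ?(ext_densC23 b d a) ?(ext_densC12 b a d).
have E4 : (ext_dens a c b = s4) * (ext_dens b a c = s4) * (ext_dens b c a = s4)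
        * (ext_dens c a b = s4) * (ext_dens c b a = s4).
  by rewrite /s4; do !split; rewrite ?(ext_densC23 c b a) ?(ext_densC12 c a b)
    ?(ext_densC23 a c b) ?(ext_densC23 b c a) ?(ext_densC12 b a c).
have D : (nbr_dens b a = nbr_dens a b) * (nbr_dens c a = nbr_dens a c) * (nbr_dens d a = nbr_dens a d)
       * (nbr_dens c b = nbr_dens b c) * (nbr_dens d b = nbr_dens b d) * (nbr_dens d c = nbr_dens c d).
  by do !split; rewrite nbr_densC.
have := @ordering_sum_ge R (cut_dens a) (cut_dens b) (cut_dens c) (cut_dens d)
  (nbr_dens a b) (nbr_dens a c) (nbr_dens a d) (nbr_dens b c) (nbr_dens b d) (nbr_dens c d)
  s1 s2 s3 s4 (1 - (s1 + s2 + s3 + s4)).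
have -> : ordering_sum (cut_dens a) (cut_dens b) (cut_dens c) (cut_dens d)
  (nbr_dens a b) (nbr_dens a c) (nbr_dens a d) (nbr_dens b c) (nbr_dens b d) (nbr_dens c d)
  s1 s2 s3 s4 = sum_all4 (fun a b c _ => weight a b c) a b c d.
  rewrite /ordering_sum /pair_term /sum_all4 /sum_last3 /sum_last2 /weight.
  rewrite !(E1, E2, E3, E4, D) -!/s1 -!/s2 -!/s3 -!/s4; ring.
apply.
- exact: cut_dens_gt0_le1 K.
- exact: cut_dens_gt0_le1 Kb.
- exact: cut_dens_gt0_le1 Kc.
- exact: cut_dens_gt0_le1 Kd.
- exact: ext_dens_gt0 K.
- exact: ext_dens_gt0 Kb.
- exact: ext_dens_gt0 Kc.
- exact: ext_dens_gt0 Kd.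
- ring.
- split.
  + by have := ext_dens_ndeg K; rewrite -/s3 -/s4; lra.
  + by have := ext_dens_ndeg Kac; rewrite !(E1, E2, E3, E4) -/s2; lra.
  + by have := ext_dens_ndeg Kad; rewrite !(E1, E2, E3, E4); lra.
- split.
  + by have := ext_dens_ndeg Kbc; rewrite !(E1, E2, E3, E4) -/s1; lra.
  + by have := ext_dens_ndeg Kbd; rewrite !(E1, E2, E3, E4); lra.
  + by have := ext_dens_ndeg Kcd; rewrite !(E1, E2, E3, E4); lra.
- split; [exact: nbr_dens_opposite K|exact: nbr_dens_opposite Kac|exact: nbr_dens_opposite Kad].
- by have := nbr_dens_sum K; rewrite -/s1 -/s2 -/s3 -/s4; lra.
- move=> dl5; split.
  + by have := cut_dens_le K; rewrite -/s1 -/s2 -/s3 -/s4; apply.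
  + have := cut_dens_le Kb; rewrite !(E1, E2, E3, E4) -/s1 -/s2.
    by rewrite [s2 + s1]addrC; apply.
  + have := cut_dens_le Kc; rewrite !(E1, E2, E3, E4) -/s1 -/s3.
    by have -> : s3 + s1 + s2 + s4 = s1 + s2 + s3 + s4 by [ring]; apply.
  + have := cut_dens_le Kd; rewrite !(E1, E2, E3, E4) -/s4.
    by have -> : s4 + s1 + s2 + s3 = s1 + s2 + s3 + s4 by [ring]; apply.
Qed.

Definition num_cliques4 : nat :=
  #|[set p : T * T * T * T | clique4 p.1.1.1 p.1.1.2 p.1.2 p.2]|.

Lemma clique_sum1 : clique_sum (fun _ _ _ _ => 1) = num_cliques4%:R.
Proof.
rewrite /num_cliques4 -sum1_card natr_sum /clique_sum.
rewrite pair_bigA /= pair_bigA /= pair_big_dep /=.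
by apply: eq_bigl => p; rewrite inE.
Qed.

Lemma num_cliques4_le : num_cliques4%:R <= 3 / 32 * #|T|%:R ^+ 4 :> R.
Proof.
(* Summing the bound 256 over all ordered copies counts the weight of each one 24 times. *)
have : 256 * num_cliques4%:R <= 24 * #|T|%:R ^+ 4 :> R.
  rewrite -clique_sum1.
  apply: (@le_trans _ _ (24 * clique_sum (fun a b c _ => weight a b c))).
    rewrite -clique_sum_all4 /clique_sum mulr_sumr ler_sum // => a _.
    rewrite mulr_sumr ler_sum // => b _; rewrite mulr_sumr ler_sum // => c _.
    rewrite mulr_sumr ler_sum // => d K; rewrite mulr1.
    exact: sum_all4_weight_ge.
  by rewrite ler_wpM2l // clique_sum_weight_le.
lra.
Qed.

End TripleSystem.

(** * Copies of K_4 in F_{3,2}-free 3-graphs *)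

(** False on triples with a repeated vertex, since then the set has fewer than three elements. *)
Definition adj (T : finType) (G : graph3 T) a b c := [set a; b; c] \in edges G.

Section Graph.
Variables (T : finType) (G : graph3 T).

Lemma adjC12 a b c : adj G a b c = adj G b a c.
Proof. by rewrite /adj (finset.setUC [set a]). Qed.

Lemma adjC23 a b c : adj G a b c = adj G a c b.
Proof. by rewrite /adj -!finset.setUA (finset.setUC [set b]). Qed.

Lemma cards3 (a b c : T) : (#|[set a; b; c]| == 3%N) = uniq [:: a; b; c].
Proof.
rewrite -finset.setUA !cardsU1 cards1 /= !inE.
by case: (a == b); case: (a == c); case: (b == c).
Qed.

Lemma adj_uniq a b c : adj G a b c -> uniq [:: a; b; c].
Proof. by rewrite -cards3; apply: (forall_inP (edgesP G)). Qed.

(** The four edges of F_{3,2} cover all ten pairs of its vertices, so the four assumed edges already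
    force [a], [b], [x], [y], [z] to be distinct. *)
Lemma adj_free :
  Ffree [set existT (fun m : nat => graph3 'I_m) 5%N F32]%classic G ->
  forall a b x y z, adj G a b x -> adj G a b y -> adj G a b z -> adj G x y z ->
  False.
Proof.
move=> GF a b x y z abx aby abz xyz.
apply: (GF 5%N F32 erefl); pose s := [:: a; b; x; y; z].
exists (fun i : 'I_5 => nth a s i) => [i j /eqP|E].
  rewrite nth_uniq ?ltn_ord //; first by move/eqP/val_inj.
  move: (adj_uniq abx) (adj_uniq aby) (adj_uniq abz) (adj_uniq xyz).
  by rewrite /= !inE; do 10 case: (_ == _).
by rewrite !inE => /orP[/orP[/orP[]|]|] /eqP->;
  rewrite /triple5 !imsetU !imset_set1 /= !inordK.
Qed.

Lemma isomorphic_K4_adj (S : {set T}) :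
  isomorphic (induced_subgraph G S) K4 ->
  {in S & &, forall a b c, uniq [:: a; b; c] -> adj G a b c}.
Proof.
case=> f fbij fE a b c aS bS cS abc.
pose E : {set {x : T | x \in S}} := [set exist _ a aS; exist _ b bS; exist _ c cS].
have valE : val @: E = [set a; b; c] by rewrite !imsetU !imset_set1.
have : E \in edges (induced_subgraph G S).
  rewrite fE inE card_imset; last exact: bij_inj.
  by rewrite -(card_imset _ val_inj) valE cards3.
by rewrite inE valE.
Qed.

(** Every triple is an edge on both sides, so any bijection works; the one used enumerates [S]. *)
Lemma isomorphic_K4P (S : {set T}) : #|S| = 4%N ->
  {in S & &, forall a b c, uniq [:: a; b; c] -> adj G a b c} ->
  isomorphic (induced_subgraph G S) K4.
Proof.
move=> S4 Sadj; have cS : #|{: {x : T | x \in S}}| = 4%N by rewrite card_sig.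
exists (cast_ord cS \o enum_rank) => [|E].
  apply: bij_comp; last exact: enum_rank_bij.
  by exists (cast_ord (esym cS)) => x; rewrite ?cast_ordK ?cast_ordKV.
rewrite !inE card_imset; last first.
  by apply: inj_comp; [exact: cast_ord_inj | exact: enum_rank_inj].
apply/idP/idP => [/(forall_inP (edgesP G))|/eqP E3].
  by rewrite (card_imset _ val_inj).
have [x xE] : exists x, x \in E by apply/card_gt0P; rewrite E3.
have [y yE] : exists y, y \in E :\ x.
  by apply/card_gt0P; move: (cardsD1 x E); rewrite xE E3; lia.
have [z zE] : exists z, z \in E :\ x :\ y.
  apply/card_gt0P; move: (cardsD1 x E) (cardsD1 y (E :\ x)).
  by rewrite xE yE E3; lia.
move: yE zE; rewrite !inE => /andP[yx yE] /and3P[zy zx zE].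
have u : uniq [:: val x; val y; val z].
  rewrite /= !inE !(inj_eq val_inj) negb_or.
  by rewrite [x == y]eq_sym yx [x == z]eq_sym zx [y == z]eq_sym zy.
suff -> : val @: E = [set val x; val y; val z].
  exact: Sadj (valP x) (valP y) (valP z) u.
apply/esym/eqP; rewrite eqEcard (card_imset _ val_inj) E3.
have /eqP-> : #|[set val x; val y; val z]| == 3%N by rewrite cards3.
by rewrite leqnn andbT !finset.subUset !finset.sub1set !imset_f.
Qed.

(** Each copy has [4! = 24] orderings as a duplicate-free 4-tuple. These tuples, collected in [U]
    and grouped by underlying set, inject into the ordered copies. *)
Lemma ecount_K4_le : (24 * ecount K4 G <= num_cliques4 (adj G))%N.
Proof.
pose A := [set S : {set T} | (#|S| == 4%N) &&
  `[< isomorphic (induced_subgraph G S) K4 >]].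
pose U := [set t : 4.-tuple T | [exists S in A, [set x in t] == S] && uniq t].
pose q (t : 4.-tuple T) := (tnth t ord0, tnth t (inord 1), tnth t (inord 2), tnth t (inord 3)).
apply: (@leq_trans #|U|).
  rewrite /ecount -/A mulnC -sum_nat_const.
  have -> : (\sum_(S in A) 24 = \sum_(S in A) #|[set t in U | [set x in t] == S]|)%N.
    apply: eq_bigr => S SA; have /andP[/eqP S4 _] : (#|S| == 4%N) &&
      `[< isomorphic (induced_subgraph G S) K4 >] by rewrite inE in SA.
    have -> : 24%N = #|S| ^_ 4 by rewrite S4.
    rewrite -(card_uniq_tuples 4 (mem S)); apply: eq_card => t.
    rewrite !inE; apply/idP/idP => [/andP[tS tu]|].
      have tSE : [set x in t] == S.
        rewrite eqEcard S4 cardsE (card_uniqP tu) size_tuple leqnn andbT.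
        by apply/fintype.subsetP => x; rewrite inE => /(allP tS).
      by rewrite tu tSE andbT andbT; apply/existsP; exists S; rewrite SA.
    case/andP=> /andP[_ ->] /eqP tSE; rewrite andbT.
    by apply/allP => x xt; rewrite /= -tSE inE.
  rewrite -sum1_card (partition_big (fun t : 4.-tuple T => [set x in t]) (mem A)) /=.
    apply: leq_sum => S SA; rewrite sum1_card; apply: subset_leq_card.
    by apply/fintype.subsetP => t; rewrite inE.
  by move=> t; rewrite inE => /andP[/existsP[S /andP[SA /eqP ->]]].
have qinj : injective q.
  move=> t t' [] e0 e1 e2 e3; apply: eq_from_tnth => i.
  have -> : i = inord (val i) by rewrite inord_val.
  case: i => [[|[|[|[|i]]]] //= lti].
  by have -> : inord 0 = ord0 :> 'I_4 by apply/val_inj; rewrite /= inordK.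
rewrite -(card_imset _ qinj) /num_cliques4; apply: subset_leq_card.
apply/fintype.subsetP => p /imsetP[t tU ->{p}].
have /andP[/existsP[S /andP[SA /eqP tS]] tu] :
  [exists S in A, [set x in t] == S] && uniq t by rewrite inE in tU.
rewrite inE /=.
have iso : isomorphic (induced_subgraph G S) K4.
  by move: SA; rewrite inE => /andP[_ /asboolP].
have tadj i j k : uniq [:: i; j; k] -> adj G (tnth t i) (tnth t j) (tnth t k).
  move=> u; have inS l : tnth t l \in S by rewrite -tS inE mem_tnth.
  apply: (isomorphic_K4_adj iso); rewrite ?inS //.
  have tinj : injective (tnth t) by exact/tuple_uniqP.
  by rewrite -(map_inj_uniq tinj) in u.
by apply/and4P; split; apply: tadj; rewrite /= !inE -!val_eqE /= ?inordK.
Qed.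

End Graph.

(** * The 4-partite construction *)

Section Partite.
Variable n : nat.

Definition colour (x : 'I_n) : 'I_4 := Ordinal (ltn_pmod x (isT : 0 < 4)%N).

Lemma partite_edgesP :
  [forall E in [set E : {set 'I_n} | (#|E| == 3) && (#|colour @: E| == 3)]%N,
    #|E| == 3%N].
Proof. by apply/forall_inP => E; rewrite inE => /andP[]. Qed.

Definition partite4 : graph3 'I_n := Graph3 partite_edgesP.

(** The edges of F_{3,2} cover every pair of its vertices, so a copy would need five distinct
    colours. *)
Lemma partite4_free :
  Ffree [set existT (fun m : nat => graph3 'I_m) 5%N F32]%classic partite4.
Proof.
(* Treating the dependent pair as a single variable [q] allows substitution without inverting an
   equality of dependent pairs. *)
suff free q : q = existT (fun m : nat => graph3 'I_m) 5%N F32 ->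
    ~ contains partite4 (projT2 q) by move=> m H /free.
move=> ->{q} [f _ fE]; pose g k := colour (f (inord k)).
have g_uniq a b c : triple5 a b c \in edges F32 -> uniq [:: g a.-1; g b.-1; g c.-1].
  move=> /fE; rewrite inE -cards3 => /andP[_].
  by rewrite /triple5 !imsetU !imset_set1.
have u123 : uniq [:: g 0; g 1; g 2] by apply: (g_uniq 1 2 3)%N; rewrite !inE eqxx.
have u124 : uniq [:: g 0; g 1; g 3] by apply: (g_uniq 1 2 4)%N; rewrite !inE eqxx ?orbT.
have u125 : uniq [:: g 0; g 1; g 4] by apply: (g_uniq 1 2 5)%N; rewrite !inE eqxx ?orbT.
have u345 : uniq [:: g 2; g 3; g 4] by apply: (g_uniq 3 4 5)%N; rewrite !inE eqxx ?orbT.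
have u : uniq [:: g 0; g 1; g 2; g 3; g 4].
  by move: u123 u124 u125 u345; rewrite /= !inE; do 10 case: (_ == _).
by have := max_card [in [:: g 0; g 1; g 2; g 3; g 4]]; rewrite (card_uniqP u) card_ord.
Qed.

Lemma div4_ord (r : 'I_4) (i : 'I_(n %/ 4)) : (4 * i + r < n)%N.
Proof. by case: r i => r /= r4 [i /= i4]; lia. Qed.

(** Keeping the first [n %/ 4] vertices of each colour makes the four classes equal in size for
    every [n]. *)
Definition class_elt (r : 'I_4) (i : 'I_(n %/ 4)) : 'I_n := Ordinal (div4_ord r i).

Lemma colour_class_elt r i : colour (class_elt r i) = r.
Proof. by apply/val_inj; rewrite /= mulnC modnMDl modn_small. Qed.

Lemma class_elt_inj r : injective (class_elt r).
Proof. by move=> i j [/addIn/eqP]; rewrite eqn_mul2l /= => /eqP/val_inj. Qed.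

(** Choosing one vertex from each truncated class gives a copy of K_4, and different choices give
    different sets. *)
Lemma ecount_partite4 : ((n %/ 4) ^ 4 <= ecount K4 partite4)%N.
Proof.
pose S (p : {ffun 'I_4 -> 'I_(n %/ 4)}) := [set class_elt r (p r) | r : 'I_4].
have colS p : {in S p &, injective colour}.
  by move=> _ _ /imsetP[r _ ->] /imsetP[r' _ ->]; rewrite !colour_class_elt => ->.
have Sinj : injective S.
  move=> p p' pp'; apply/ffunP => r.
  have /imsetP[r' _ E] : class_elt r (p r) \in S p' by rewrite -pp'; apply/imsetP; exists r.
  have rr' : r = r' by rewrite -[LHS](colour_class_elt r (p r)) E colour_class_elt.
  by move: E; rewrite -rr' => /class_elt_inj.
have -> : ((n %/ 4) ^ 4 = #|S @: [set: {ffun 'I_4 -> 'I_(n %/ 4)}]|)%N.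
  by rewrite (card_imset _ Sinj) cardsT card_ffun !card_ord.
apply: subset_leq_card; apply/fintype.subsetP => _ /imsetP[p _ ->].
have S4 : #|S p| = 4%N.
  rewrite card_imset ?card_ord // => r r' E.
  by rewrite -(colour_class_elt r (p r)) E colour_class_elt.
rewrite inE S4 eqxx; apply/asboolP/isomorphic_K4P => // a b c aS bS cS abc.
rewrite /adj inE cards3 abc card_in_imset ?cards3 //.
by move=> x y; rewrite !inE -!orbA => /or3P[]/eqP-> /or3P[]/eqP->; apply: (colS p).
Qed.

End Partite.

(** * The density *)

Lemma exH_ge n :
  ((n %/ 4) ^ 4 <=
     exH K4 n [set existT (fun m : nat => graph3 'I_m) 5%N F32]%classic)%N.
Proof.
apply: leq_trans (ecount_partite4 n) _.
by apply: leq_bigmax_cond; apply/asboolP; exact: partite4_free.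
Qed.

(** Dividing the bound [3/32 * n ^ 4] on ordered copies by 24 gives [n ^ 4 / 256]. *)
Lemma exH_le n :
  (256 * exH K4 n [set existT (fun m : nat => graph3 'I_m) 5%N F32]%classic
     <= n ^ 4)%N.
Proof.
rewrite mulnC -leq_divRL //; apply/bigmax_leqP => G /asboolP GF.
rewrite leq_divRL //.
have := num_cliques4_le (@adjC12 _ G) (@adjC23 _ G) (adj_free GF) rat.
have := ecount_K4_le G; rewrite -(ler_nat rat) natrM card_ord => h1 h2.
by rewrite -(ler_nat rat) natrM natrX; lra.
Qed.

Lemma bin4_natr (R : realFieldType) k :
  'C(k.+4, 4)%:R = k.+4%:R * k.+3%:R * k.+2%:R * k.+1%:R / 24 :> R.
Proof.
apply: (canRL (mulfK _)); first by rewrite pnatr_eq0.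
have -> : 24 = 4`!%:R :> R by [].
by rewrite -[LHS]natrM bin_ffact !ffactnS ffactn0 muln1 !natrM !mulrA.
Qed.

(** With [n = k + 4], ['C(n, 4)] lies between [(k + 4) * (k + 1) ^ 3 / 24] and
    [(k + 4) ^ 3 * (k + 1) / 24], which turns the bounds on [exH] into powers of [y], a ratio
    tending to 1. *)
Lemma ex_ratio_bounds (R : realType) k (y := k.+4%:R / k.+1%:R : R) :
  3 / 32 * (y ^+ 3)^-1 <=
    ex_ratio R K4 [set existT (fun m : nat => graph3 'I_m) 5%N F32]%classic k.+4
    <= 3 / 32 * y ^+ 3.
Proof.
rewrite /ex_ratio bin4_natr.
have := exH_le k.+4; have := exH_ge k.+4; set E := exH _ _ _.
(* Rounding [k + 4] down to a multiple of 4 loses at most 3. *)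
have m4 : (k.+1 <= 4 * (k.+4 %/ 4))%N by lia.
move=> lo; rewrite -(ler_nat R) natrM natrX => hi.
have {}lo : k.+1%:R ^+ 4 <= 256 * E%:R :> R.
  rewrite -natrX -natrM ler_nat; apply: (@leq_trans ((4 * (k.+4 %/ 4)) ^ 4)).
    by rewrite leq_exp2r.
  by rewrite expnMn leq_mul2l.
have e4 : k.+4%:R = k%:R + 4 :> R by rewrite -addn4 natrD.
have e3 : k.+3%:R = k%:R + 3 :> R by rewrite -addn3 natrD.
have e2 : k.+2%:R = k%:R + 2 :> R by rewrite -addn2 natrD.
have e1 : k.+1%:R = k%:R + 1 :> R by rewrite -addn1 natrD.
rewrite /y e1 e2 e3 e4 in lo hi *; move: (ler0n R k) (E%:R) lo hi.
move: (k%:R) => {E m4 e1 e2 e3 e4 y}x x0 E lo hi.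
have P0 : 0 < (x + 4) * (x + 3) * (x + 2) * (x + 1) / 24.
  by rewrite !mulr_gt0 ?invr_gt0 //; lra.
have y1 : (x + 1) != 0 by rewrite gt_eqF //; lra.
have y4 : (x + 4) != 0 by rewrite gt_eqF //; lra.
have q0 : 0 < (x + 4) / (x + 1) by rewrite divr_gt0 //; lra.
apply/andP; split; rewrite ?ler_pdivlMr ?ler_pdivrMr //.
  have : (x + 4) * (x + 3) * (x + 2) * (x + 1) <= (x + 4) ^+ 3 * (x + 1).
    have : (x + 3) * (x + 2) <= (x + 4) ^+ 2 by nra.
    move=> h; have : 0 <= (x + 4) * (x + 1) by rewrite mulr_ge0 //; lra.
    by move=> /ler_wpM2l/(_ _ _ h); rewrite !exprS expr0; nra.
  move=> h; have c0 : 0 <= 3 / 32 * (((x + 4) / (x + 1)) ^+ 3)^-1 / 24.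
    by rewrite !mulr_ge0 ?invr_ge0 ?exprn_ge0 ?(ltW q0).
  have := ler_wpM2l c0 h.
  have -> : 3 / 32 * (((x + 4) / (x + 1)) ^+ 3)^-1 / 24 * ((x + 4) ^+ 3 * (x + 1))
    = (x + 1) ^+ 4 / 256 by field; rewrite y1 y4.
  by lra.
have : (x + 4) * (x + 1) ^+ 3 <= (x + 4) * (x + 3) * (x + 2) * (x + 1).
  have : (x + 1) ^+ 2 <= (x + 3) * (x + 2) by nra.
  move=> h; have : 0 <= (x + 4) * (x + 1) by rewrite mulr_ge0 //; lra.
  by move=> /ler_wpM2l/(_ _ _ h); rewrite !exprS expr0; nra.
move=> h; have c0 : 0 <= 3 / 32 * ((x + 4) / (x + 1)) ^+ 3 / 24.
  by apply: divr_ge0 => //; apply: mulr_ge0 => //; apply: exprn_ge0; apply: ltW.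
have := ler_wpM2l c0 h.
have -> : 3 / 32 * ((x + 4) / (x + 1)) ^+ 3 / 24 * ((x + 4) * (x + 1) ^+ 3)
  = (x + 4) ^+ 4 / 256 by field.
by lra.
Qed.

Theorem theorem2p23 (R : realType) :
  turan_density R K4 [set existT (fun m : nat => graph3 'I_m) 5%N F32]%classic
    = 3 / 32.
Proof.
apply: cvg_lim => //; rewrite -(cvg_shiftn 4).
(* [harmonic k] is [1 / (k + 1)], so this expression is the ratio [y] of [ex_ratio_bounds]. *)
have y1 : ((1 + 3 * harmonic k : R) @[k --> \oo] --> (1 + 3 * 0 : R))%classic.
  by apply: cvgD; [exact: cvg_cst|apply: cvgM; [exact: cvg_cst|exact: cvg_harmonic]].
have y3 : ((1 + 3 * harmonic k : R) ^+ 3 @[k --> \oo] -->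
    ((1 + 3 * 0) ^+ 3 : R))%classic.
  exact: cvgM y1 (cvgM y1 y1).
rewrite mulr0 addr0 expr1n in y3.
have lo : (3 / 32 * ((1 + 3 * harmonic k : R) ^+ 3)^-1 @[k --> \oo] -->
    (3 / 32 * 1^-1 : R))%classic.
  by apply: cvgM; [exact: cvg_cst|apply: cvgV => //; exact: oner_neq0].
have hi : (3 / 32 * (1 + 3 * harmonic k : R) ^+ 3 @[k --> \oo] -->
    (3 / 32 * 1 : R))%classic by apply: cvgM => //; exact: cvg_cst.
rewrite ?invr1 !mulr1 in lo hi.
apply: squeeze_cvgr lo hi; apply: nearW => k.
have := ex_ratio_bounds R k; rewrite /= addn4.
have -> // : k.+4%:R / k.+1%:R = 1 + 3 * k.+1%:R^-1 :> R.
have -> : k.+4%:R = k.+1%:R + 3 :> R by rewrite -natrD addn3.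
by rewrite mulrDl divff // pnatr_eq0.
Qed.
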